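(* Let $A,B\in\mathbb{M}_n$. Then there exist two unitaries $U,V\in\mathbb{M}_n$ such that $$|A+B|_{\mathrm{qsym}}\le U|A|_{\mathrm{qsym}}U^*+V|B|_{\mathrm{qsym}}V^*.$$
   Context: $\mathbb{M}_n$ is the space of $n\times n$ complex matrices. For $Z\in\mathbb{M}_n$, $|Z|=(Z^*Z)^{1/2}$, and the quadratic symmetric modulus is $|Z|_{\mathrm{qsym}}=\left(\frac{|Z|^2+|Z^*|^2}{2}\right)^{1/2}=\left(\frac{Z^*Z+ZZ^*}{2}\right)^{1/2}$. For Hermitian matrices, $X\le Y$ means $Y-X$ is positive semidefinite. *)

(* Defs.v *)
From HB Require Import structures.
From mathcomp Require Import all_boot all_order all_algebra.

Set Implicit Arguments.
Unset Strict Implicit.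
Unset Printing Implicit Defensive.

Import Order.TTheory GRing.Theory Num.Theory.
Local Open Scope ring_scope.
Local Open Scope sesquilinear_scope.

(* In a [numClosedFieldType] such as the complex numbers, [0 <= z] entails that
   [z] is real. *)
Definition psdmx (C : numClosedFieldType) (n : nat) (M : 'M[C]_n) : Prop :=
  M \is hermsymmx /\ forall x : 'cV[C]_n, 0 <= (x ^t* *m M *m x) 0 0.

Definition loewner_le (C : numClosedFieldType) (n : nat) (X Y : 'M[C]_n) :
  Prop := psdmx (Y - X).

(* Square root by functional calculus on a spectral decomposition. It is only
   meaningful for positive semidefinite [M], where it is the unique positive
   semidefinite square root: see [sqrtmx_psd], [sqrtmxK] and [sqrtmx_uniq]. *)
Definition sqrtmx (C : numClosedFieldType) (n : nat) (M : 'M[C]_n) : 'M[C]_n :=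
  invmx (spectralmx M) *m diag_mx (map_mx sqrtC (spectral_diag M))
    *m spectralmx M.

Definition absmx (C : numClosedFieldType) (n : nat) (Z : 'M[C]_n) : 'M[C]_n :=
  sqrtmx (Z ^t* *m Z).

Definition qsymmx (C : numClosedFieldType) (n : nat) (Z : 'M[C]_n) : 'M[C]_n :=
  sqrtmx (2%:R^-1 *:
    (absmx Z *m absmx Z + absmx (Z ^t*) *m absmx (Z ^t*))).

Section Facts.
Variables (C : numClosedFieldType) (n : nat).
Implicit Types (M S Z : 'M[C]_n).

Lemma hermsymmxE M : (M \is hermsymmx) = (M == M ^t*).
Proof. by rewrite qualifE /= expr0 scale1r. Qed.

Lemma adjmxM m p q (A : 'M[C]_(m, p)) (B : 'M[C]_(p, q)) :
  (A *m B) ^t* = B ^t* *m A ^t*.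
Proof. by rewrite trmx_mul map_mxM. Qed.

Lemma psdmx_gram m (Z : 'M[C]_(m, n)) : psdmx (Z ^t* *m Z).
Proof.
split; first by rewrite hermsymmxE adjmxM trmxCK.
move=> x; rewrite mulmxA -adjmxM -mulmxA mxE; apply: sumr_ge0 => i _.
by rewrite !mxE mulrC mul_conjC_ge0.
Qed.

Lemma psdmxD M S : psdmx M -> psdmx S -> psdmx (M + S).
Proof.
move=> [hM pM] [hS pS]; split.
  move: hM hS; rewrite !hermsymmxE => /eqP hM /eqP hS.
  by rewrite linearD /= map_mxD -hM -hS.
by move=> x; rewrite mulmxDr mulmxDl mxE addr_ge0.
Qed.

Lemma psdmxZ (a : C) M : 0 <= a -> psdmx M -> psdmx (a *: M).
Proof.
move=> a0 [hM pM]; split.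
  move: hM; rewrite !hermsymmxE => /eqP hM.
  by rewrite linearZ /= map_mxZ -hM /= (geC0_conj a0).
by move=> x; rewrite -scalemxAr -scalemxAl mxE mulr_ge0.
Qed.

Lemma psdmx_spectral M : psdmx M ->
  M = invmx (spectralmx M) *m diag_mx (spectral_diag M) *m spectralmx M.
Proof. by case=> /hermitian_normalmx /orthomx_spectralP. Qed.

Lemma psdmx_spectral_diag_ge0 M : psdmx M -> forall i, 0 <= spectral_diag M 0 i.
Proof.
move=> pM i; have defM := psdmx_spectral pM.
have uP := spectral_unitarymx M; case: pM => _.
move/(_ ((spectralmx M) ^t* *m delta_mx i 0)).
rewrite [X in _ *m X *m _]defM (invmx_unitary uP) adjmxM trmxCK.
move/unitarymxP: uP => uP.
rewrite !mulmxA -(mulmxA _ (spectralmx M)) uP mulmx1.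
rewrite -(mulmxA _ (spectralmx M)) uP mulmx1.
by rewrite trmx_delta map_delta_mx -rowE -colE !mxE eqxx.
Qed.

Lemma sqrtmx_psd M : psdmx M -> psdmx (sqrtmx M).
Proof.
move=> pM; have d0 := psdmx_spectral_diag_ge0 pM.
rewrite /sqrtmx invmx_unitary ?spectral_unitarymx //.
set D := diag_mx _.
have -> : D = (diag_mx (map_mx (fun z => sqrtC (sqrtC z)) (spectral_diag M))) ^t*
      *m diag_mx (map_mx (fun z => sqrtC (sqrtC z)) (spectral_diag M)).
  rewrite tr_diag_mx map_diag_mx mulmx_diag; congr diag_mx.
  by apply/rowP => i; rewrite !mxE /= geC0_conj ?sqrtC_ge0 // -expr2 sqrtCK.
by rewrite mulmxA -adjmxM -mulmxA; apply: psdmx_gram.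
Qed.

Lemma sqrtmxK M : psdmx M -> sqrtmx M *m sqrtmx M = M.
Proof.
move=> pM; rewrite [RHS]psdmx_spectral // /sqrtmx.
rewrite !mulmxA mulmxK ?spectral_unit //.
rewrite -(mulmxA (invmx _) (diag_mx _) (diag_mx _)) mulmx_diag.
by congr (_ *m diag_mx _ *m _); apply/rowP => i; rewrite !mxE -expr2 sqrtCK.
Qed.

Lemma sqrtmx_uniq M S : psdmx S -> S *m S = M -> sqrtmx M = S.
Proof.
move=> pS defM.
have pM : psdmx M.
  have [/[!hermsymmxE]/eqP hS _] := pS.
  by rewrite -defM {1}hS; apply: psdmx_gram.
have uP := spectral_unit M; have uQ := spectral_unit S.
have S0 := psdmx_spectral_diag_ge0 pS.
have M0 := psdmx_spectral_diag_ge0 pM.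
have eS := psdmx_spectral pS.
have := sqrtmxK pM; rewrite -[in RHS]defM /sqrtmx.
set P := spectralmx M in uP *; set Q := spectralmx S in uQ eS *.
set e := map_mx _ _; set d := spectral_diag S in S0 eS *.
have e0 i : 0 <= e 0 i by rewrite mxE sqrtC_ge0.
clearbody P Q d e; rewrite eS !mulmxA !mulmxK //.
rewrite -(mulmxA (invmx P) (diag_mx e) (diag_mx e)).
rewrite -(mulmxA (invmx Q) (diag_mx d) (diag_mx d)) !mulmx_diag => E.
suff W : diag_mx e *m (P *m invmx Q) = (P *m invmx Q) *m diag_mx d.
  rewrite -[LHS](mulmxKV uQ); congr (_ *m _).
  by rewrite -!mulmxA W !mulmxA mulVmx // mul1mx.
have {}E := congr1 (fun X => P *m X *m invmx Q) E.
rewrite !mulmxA mulmxV // mul1mx mulmxK // -mulmxA in E.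
move: (P *m invmx Q) E => W /matrixP E; apply/matrixP => i j; move: (E i j).
rewrite !mul_diag_mx !mul_mx_diag !mxE.
have [->|W0] := eqVneq (W i j) 0; first by rewrite !mulr0 !mul0r.
rewrite [RHS]mulrC => /(mulIf W0) /eqP.
by rewrite -!expr2 eqrXn2 // => /eqP ->; rewrite mulrC.
Qed.

Lemma absmx_sqr Z : absmx Z *m absmx Z = Z ^t* *m Z.
Proof. by rewrite sqrtmxK //; apply: psdmx_gram. Qed.

Lemma qsymmxE Z : qsymmx Z = sqrtmx (2%:R^-1 *: (Z ^t* *m Z + Z *m Z ^t*)).
Proof. by rewrite /qsymmx !absmx_sqr trmxCK. Qed.

Lemma qsymmx_radicand_psd Z :
  psdmx (2%:R^-1 *: (Z ^t* *m Z + Z *m Z ^t*)).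
Proof.
apply: psdmxZ; first by rewrite invr_ge0 ler0n.
apply: psdmxD; first exact: psdmx_gram.
by have := psdmx_gram (Z ^t*); rewrite trmxCK.
Qed.

Lemma qsymmx_psd Z : psdmx (qsymmx Z).
Proof. by rewrite qsymmxE; apply/sqrtmx_psd/qsymmx_radicand_psd. Qed.

Lemma qsymmx_sqr Z :
  qsymmx Z *m qsymmx Z = 2%:R^-1 *: (Z ^t* *m Z + Z *m Z ^t*).
Proof. by rewrite qsymmxE sqrtmxK //; apply: qsymmx_radicand_psd. Qed.

End Facts.

(* Main.v *)
(* Thompson's triangle inequality applied to the tall matrix
   T(Z) = [Z; Z^*] / sqrt 2, which is additive in Z and satisfies
   |T(Z)| = |Z|_qsym. A contraction W with |T(A + B)| = W^* T(A + B) splits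
   |A + B|_qsym as Re (W^* T(A)) + Re (W^* T(B)), and each Re (W^* T) lies below
   a unitary conjugate of |T| because its ordered eigenvalues do not exceed
   those of |T|. *)

Require Import Defs.
From HB Require Import structures.
From mathcomp Require Import all_boot all_order all_algebra.
From mathcomp Require Import perm reals complex.

Set Implicit Arguments.
Unset Strict Implicit.
Unset Printing Implicit Defensive.

Import Order.TTheory GRing.Theory Num.Theory.
Local Open Scope ring_scope.
Local Open Scope complex_scope.
Local Open Scope sesquilinear_scope.

Section Modulus.
Variable C : numClosedFieldType.

(** * Squared Euclidean norm and quadratic forms in unitary coordinates *)

Definition sqnorm m (x : 'cV[C]_m) : C := \sum_i `|x i 0| ^+ 2.

Lemma adjmxD m p (A B : 'M[C]_(m, p)) : (A + B) ^t* = A ^t* + B ^t*.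
Proof. by rewrite linearD map_mxD. Qed.

Lemma adjmxZ m p (a : C) (A : 'M[C]_(m, p)) : (a *: A) ^t* = a^*%R *: A ^t*.
Proof. by rewrite linearZ map_mxZ. Qed.

Lemma adjmx_unitary n (P : 'M[C]_n) : P \is unitarymx -> P ^t* \is unitarymx.
Proof. by rewrite trmxC_unitary. Qed.

Lemma unitary_adjmulmx n (P : 'M[C]_n) : P \is unitarymx -> P ^t* *m P = 1%:M.
Proof. by move/adjmx_unitary/unitarymxP; rewrite trmxCK. Qed.

Lemma sqnormE m (x : 'cV[C]_m) : sqnorm x = (x ^t* *m x) 0 0.
Proof. by rewrite mxE; apply: eq_bigr => i _; rewrite !mxE normCK mulrC. Qed.

Lemma sqnorm_ge0 m (x : 'cV[C]_m) : 0 <= sqnorm x.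
Proof. by apply: sumr_ge0 => i _; rewrite exprn_ge0. Qed.

Lemma sqnorm_eq0 m (x : 'cV[C]_m) : (sqnorm x == 0) = (x == 0).
Proof.
apply/eqP/eqP => [/psumr_eq0P x0|->]; last first.
  by rewrite /sqnorm big1 // => i _; rewrite mxE normr0 expr0n.
apply/colP => i; rewrite mxE; apply/eqP; rewrite -normr_eq0 -sqrf_eq0.
by rewrite x0 // => j _; rewrite exprn_ge0.
Qed.

Lemma sqnorm_mulmx m p (A : 'M[C]_(m, p)) (x : 'cV[C]_p) :
  sqnorm (A *m x) = (x ^t* *m (A ^t* *m A) *m x) 0 0.
Proof. by rewrite sqnormE adjmxM !mulmxA. Qed.

Lemma sqnorm_unitary n (P : 'M[C]_n) (x : 'cV[C]_n) :
  P \is unitarymx -> sqnorm (P *m x) = sqnorm x.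
Proof.
by move=> uP; rewrite sqnorm_mulmx unitary_adjmulmx // mulmx1 -sqnormE.
Qed.

Lemma diag_form m (d : 'rV[C]_m) (x : 'cV[C]_m) :
  (x ^t* *m diag_mx d *m x) 0 0 = \sum_i d 0 i * `|x i 0| ^+ 2.
Proof.
rewrite -mulmxA mul_diag_mx mxE; apply: eq_bigr => i _.
by rewrite !mxE normCK mulrCA [(x i 0)^*%R * _]mulrC.
Qed.

Lemma unitary_diag_form n (P : 'M[C]_n) (d : 'rV[C]_n) (x : 'cV[C]_n) :
  (x ^t* *m (P ^t* *m diag_mx d *m P) *m x) 0 0 =
  \sum_i d 0 i * `|(P *m x) i 0| ^+ 2.
Proof. by rewrite -diag_form adjmxM !mulmxA. Qed.

Lemma psdmx_unitary_diag n (P : 'M[C]_n) (d : 'rV[C]_n) :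
  (forall i, 0 <= d 0 i) -> psdmx (P ^t* *m diag_mx d *m P).
Proof.
move=> d0; split=> [|x]; last first.
  by rewrite unitary_diag_form sumr_ge0 // => i _; rewrite mulr_ge0 ?exprn_ge0.
rewrite hermsymmxE !adjmxM trmxCK mulmxA tr_diag_mx map_diag_mx.
apply/eqP; congr (_ *m diag_mx _ *m _).
by apply/rowP => i; rewrite mxE /= geC0_conj.
Qed.

(** * Spectral decompositions with decreasing eigenvalues *)

(** The order of [C] is partial, so realness is what makes the comparison total. A permutation is
    produced, rather than a sorted list, so that eigenvectors can be reordered along with their
    eigenvalues. *)
Lemma sort_ordinals n (d : 'I_n -> C) : (forall i, d i \is Num.real) ->
  exists s : {perm 'I_n}, forall i j : 'I_n, (i <= j)%N -> d (s j) <= d (s i).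
Proof.
move=> dr; pose e : rel 'I_n := fun i j => d j <= d i.
have e_total : total e by move=> i j; rewrite /e; apply: real_leVge.
have e_trans : transitive e by move=> j i k; rewrite /e => ij jk; apply: le_trans ij.
pose t := sort e (enum 'I_n).
have st : size t = n by rewrite size_sort size_enum_ord.
have ut : uniq t by rewrite sort_uniq enum_uniq.
(* The default of [nth] is never reached, as [t] has size [n]; taking the index itself avoids
   exhibiting an element of ['I_n], which may be empty. *)
have inj_t : injective (fun i : 'I_n => nth i t i).
  move=> i j; rewrite (set_nth_default j) ?st // => /eqP.
  by rewrite nth_uniq ?st // => /eqP/val_inj.
exists (perm inj_t) => i j ij; rewrite !permE (set_nth_default i) ?st //.
apply: (sorted_leq_nth e_trans) => //; rewrite ?inE ?st //.
- by move=> k; rewrite /e.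
- exact: sort_sorted.
Qed.

Lemma hermitian_sorted_spectral n (M : 'M[C]_n) : M \is hermsymmx ->
  exists P : 'M[C]_n, exists d : 'rV[C]_n,
    [/\ P \is unitarymx, M = P ^t* *m diag_mx d *m P &
        forall i j : 'I_n, (i <= j)%N -> d 0 j <= d 0 i].
Proof.
move=> hM.
have /sort_ordinals[s ds] : forall i, spectral_diag M 0 i \is Num.real.
  by move=> i; have /mxOverP := hermitian_spectral_diag_real hM; apply.
have uP := spectral_unitarymx M.
have eM : M = (spectralmx M) ^t* *m diag_mx (spectral_diag M) *m spectralmx M.
  by rewrite -invmx_unitary //; apply/orthomx_spectralP/hermitian_normalmx.
exists (row_perm s (spectralmx M)), (col_perm s (spectral_diag M)); split.
- have /unitarymxP/matrixP PP := uP.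
  apply/unitarymxP/matrixP => i j; have := PP (s i) (s j).
  rewrite !mxE (inj_eq perm_inj) => <-.
  by apply: eq_bigr => k _; rewrite !mxE.
- rewrite {1}eM; apply/matrixP => i j; rewrite !mul_mx_diag !mxE.
  rewrite (reindex_inj (@perm_inj _ s)); apply: eq_bigr => k _.
  by rewrite !mxE.
- by move=> i j /ds; rewrite !mxE.
Qed.

(** * Comparison of ordered eigenvalues *)

(** For eigenbases sorted by decreasing eigenvalue, [x] lies both in the span of the first j + 1
    eigenvectors of one matrix and in that of the last n - j of the other; these dimensions add up
    to n + 1. *)
Lemma common_test_vector n (P Q : 'M[C]_n) (j : 'I_n) :
  exists x : 'cV[C]_n, [/\ x != 0,
    forall i : 'I_n, (i < j)%N -> (Q *m x) i 0 = 0 &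
    forall i : 'I_n, (j < i)%N -> (P *m x) i 0 = 0].
Proof.
(* Only n - 1 linear conditions: the j-th row of the system is zero. *)
pose G := \matrix_(i, k) (if (i < j)%N then Q i k else
                          if (j < i)%N then P i k else 0).
have : \det G^T == 0.
  rewrite det_tr (expand_det_row _ j) big1 // => k _.
  by rewrite mxE ltnn mul0r.
case/det0P => v v0 /(congr1 trmx); rewrite trmx_mul trmxK trmx0 => Gv.
exists v^T; split=> [|i ij|i ji]; first by rewrite trmx_eq0.
- have /colP/(_ i) := Gv; rewrite [RHS]mxE => <-; rewrite !mxE.
  by apply: eq_bigr => k _; rewrite !mxE ij.
- have /colP/(_ i) := Gv; rewrite [RHS]mxE => <-; rewrite !mxE.
  by apply: eq_bigr => k _; rewrite !mxE ji ltnNge ltnW.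
Qed.

Lemma real_part_form_le m n (W T : 'M[C]_(m, n)) (x : 'cV[C]_n) (c : C) :
  0 <= c -> sqnorm (W *m x) <= sqnorm x ->
  sqnorm (T *m x) <= c ^+ 2 * sqnorm x ->
  (x ^t* *m (2%:R^-1 *: (W ^t* *m T + T ^t* *m W)) *m x) 0 0 <= c * sqnorm x.
Proof.
(* Expand 0 <= |c W x - T x|^2 and divide by c, which needs c != 0. *)
move=> c0 Wx Tx; set r := (_ *m _ *m x) 0 0.
have r2 : r *+ 2 = ((W *m x) ^t* *m (T *m x) + (T *m x) ^t* *m (W *m x)) 0 0.
  rewrite /r -scalemxAr -scalemxAl mxE -mulr_natl mulVKf ?pnatr_eq0 //.
  by rewrite mulmxDr mulmxDl !adjmxM !mulmxA.
move: c0; rewrite le_eqVlt => /predU1P[c0|c0].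
  (* If c = 0, the bound on T x forces T x = 0, and both cross terms vanish. *)
  move: Tx; rewrite -c0 expr0n !mul0r => Tx.
  have /eqP Tx0 : T *m x == 0 by rewrite -sqnorm_eq0 eq_le Tx sqnorm_ge0.
  move: r2; rewrite Tx0 mulmx0 [0^T]trmx0 map_mx0 mul0mx addr0 mxE.
  by move/eqP; rewrite mulrn_eq0 /= => /eqP ->.
have := sqnorm_ge0 (c *: (W *m x) - T *m x).
have -> : sqnorm (c *: (W *m x) - T *m x) =
    c ^+ 2 * sqnorm (W *m x) + sqnorm (T *m x) - c * (r *+ 2).
  rewrite r2 !sqnormE -scaleN1r adjmxD !adjmxZ rmorphN1 (geC0_conj (ltW c0)).
  rewrite mulmxDr !mulmxDl -!scalemxAl -!scalemxAr !scalerA !mxE.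
  rewrite mulrN1 !mulN1r opprK mul1r expr2 mulrDr opprD !mulNr.
  by rewrite [X in _ + X = _]addrC addrACA [X in _ + X = _]addrC.
(* The two hypotheses turn the expansion into 2 c r <= 2 c^2 |x|^2, from which 2 c cancels. *)
rewrite subr_ge0 => le_r; have := le_trans le_r (lerD (ler_wpM2l _ Wx) Tx).
rewrite exprn_ge0 ?(ltW c0) // => /(_ isT).
by rewrite -mulr2n expr2 -mulrA -mulrnAr ler_pM2l // lerMn2r.
Qed.

(* Courant-Fischer bounds the sorted eigenvalues of the real part of W^* T by
   those of K; U aligns the two sorted eigenbases. *)
Lemma real_part_le_unitary_orbit m n (W T : 'M[C]_(m, n)) (K : 'M[C]_n) :
  (forall x, sqnorm (W *m x) <= sqnorm x) -> psdmx K ->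
  K *m K = T ^t* *m T ->
  exists2 U : 'M[C]_n, U \is unitarymx &
    loewner_le (2%:R^-1 *: (W ^t* *m T + T ^t* *m W)) (U *m K *m U ^t*).
Proof.
move=> cW [hK pK] KK; set H := 2%:R^-1 *: _.
have hH : H \is hermsymmx.
  rewrite hermsymmxE /H adjmxZ adjmxD !adjmxM !trmxCK addrC.
  by rewrite geC0_conj // invr_ge0 ler0n.
have [P [h [uP eH sh]]] := hermitian_sorted_spectral hH.
have [Q [k [uQ eK sk]]] := hermitian_sorted_spectral hK.
have QQ : Q *m Q ^t* = 1%:M by apply/unitarymxP.
(* The form of [K] at its i-th eigenvector, the i-th column of [Q ^t*], is the eigenvalue
   [k 0 i]. *)
have k0 i : 0 <= k 0 i.
  have := pK (Q ^t* *m delta_mx i 0); rewrite eK unitary_diag_form.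
  rewrite mulmxA QQ mul1mx (bigD1 i) //= big1 => [|l li].
    by rewrite mxE !eqxx normr1 expr1n mulr1 addr0.
  by rewrite mxE (negPf li) normr0 expr0n mulr0.
have KKE : K *m K = Q ^t* *m diag_mx (\row_i (k 0 i ^+ 2)) *m Q.
  rewrite {1 2}eK -!mulmxA; congr (_ *m _); rewrite (mulmxA Q) QQ mul1mx.
  by rewrite mulmxA mulmx_diag; congr (diag_mx _ *m _).
have hk j : h 0 j <= k 0 j.
  (* Only the P-coordinates i <= j of [x] survive, so h_j |x|^2 is at most the form of [H] at [x].
     Only its Q-coordinates i >= j survive, so |T x|^2, the form of K^2 at [x], is at most k_j^2
     |x|^2. *)
  have [x [x0 Qx Px]] := common_test_vector P Q j.
  have x_gt0 : 0 < sqnorm x by rewrite lt_def sqnorm_eq0 x0 sqnorm_ge0.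
  rewrite -(ler_pM2r x_gt0);
    apply: le_trans (real_part_form_le (T := T) (k0 j) (cW x) _).
    rewrite -/H eH unitary_diag_form -(sqnorm_unitary x uP) mulr_sumr.
    apply: ler_sum => i _; have [ij|ji] := leqP i j.
      by rewrite ler_wpM2r ?exprn_ge0 // sh.
    by rewrite Px // normr0 expr0n !mulr0.
  rewrite sqnorm_mulmx -KK KKE unitary_diag_form -(sqnorm_unitary x uQ) mulr_sumr.
  apply: ler_sum => i _; have [ji|ij] := leqP j i.
    by rewrite ler_wpM2r ?exprn_ge0 // mxE ler_sqr ?nnegrE // sk.
  by rewrite Qx // normr0 expr0n !mulr0.
exists (P ^t* *m Q); first by rewrite mul_unitarymx ?adjmx_unitary.
rewrite /loewner_le.
have -> : P ^t* *m Q *m K *m (P ^t* *m Q) ^t* - H =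
    P ^t* *m diag_mx (k - h) *m P.
  rewrite {1}eH {1}eK adjmxM trmxCK raddfB /= mulmxBr mulmxBl; congr (_ - _).
  rewrite -!mulmxA; congr (_ *m _); rewrite (mulmxA Q) QQ mul1mx.
  by congr (_ *m _); rewrite mulmxA QQ mul1mx.
by apply: psdmx_unitary_diag => i; rewrite !mxE subr_ge0.
Qed.

(** Take W = T L with L the Moore-Penrose inverse of K. Then W^* T = L K^2 = K, while W^* W = L K^2
    L is the orthogonal projection onto the range of K. *)
Lemma polar_contraction m n (T : 'M[C]_(m, n)) (K : 'M[C]_n) :
  psdmx K -> K *m K = T ^t* *m T ->
  exists2 W : 'M[C]_(m, n), W ^t* *m T = K &
    forall x, sqnorm (W *m x) <= sqnorm x.
Proof.
move=> pK KK; have d0 := psdmx_spectral_diag_ge0 pK.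
have uP := spectral_unitarymx K; have eK := psdmx_spectral pK.
rewrite invmx_unitary // in eK.
set P := spectralmx K in uP eK; set d := spectral_diag K in d0 eK.
have PP : P *m P ^t* = 1%:M by apply/unitarymxP.
(* diag_mx f is the pseudo-inverse of diag_mx d, as 0^-1 = 0. *)
pose f := map_mx GRing.inv d.
pose L := P ^t* *m diag_mx f *m P.
have LE : L ^t* = L.
  have [+ _] : psdmx L by apply: psdmx_unitary_diag => i; rewrite mxE invr_ge0.
  by rewrite hermsymmxE => /eqP <-.
have mulPd (a b : 'rV[C]_n) : P ^t* *m diag_mx a *m P *m (P ^t* *m diag_mx b *m P)
    = P ^t* *m diag_mx (\row_i (a 0 i * b 0 i)) *m P.
  rewrite -!mulmxA; congr (_ *m _); rewrite (mulmxA P) PP mul1mx.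
  by rewrite mulmxA mulmx_diag.
exists (T *m L) => [|x].
  rewrite adjmxM LE -mulmxA -KK {1 2}eK /L !mulPd [RHS]eK.
  congr (_ *m diag_mx _ *m _); apply/rowP => i; rewrite !mxE.
  by have [->|di] := eqVneq (d 0 i) 0; rewrite ?mulr0 // mulKf.
have -> : sqnorm (T *m L *m x) = (x ^t* *m (L *m (K *m K) *m L) *m x) 0 0.
  by rewrite sqnorm_mulmx adjmxM LE KK !mulmxA.
rewrite {1 2}eK /L !mulPd unitary_diag_form -(sqnorm_unitary x uP).
apply: ler_sum => i _; rewrite !mxE; have [->|di] := eqVneq (d 0 i) 0.
  by rewrite !(mulr0, mul0r) exprn_ge0.
by rewrite mulKf // mulfV // mul1r.
Qed.

(** * Reduction of the quadratic symmetric modulus to an ordinary modulus *)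

Definition qsymcol n (Z : 'M[C]_n) : 'M[C]_(n + n, n) :=
  sqrtC 2%:R^-1 *: col_mx Z (Z ^t*).

Lemma qsymcolD n (A B : 'M[C]_n) : qsymcol (A + B) = qsymcol A + qsymcol B.
Proof. by rewrite /qsymcol adjmxD -add_col_mx scalerDr. Qed.

Lemma qsymmx_sqr_qsymcol n (Z : 'M[C]_n) :
  qsymmx Z *m qsymmx Z = (qsymcol Z) ^t* *m qsymcol Z.
Proof.
rewrite qsymmx_sqr /qsymcol adjmxZ geC0_conj ?sqrtC_ge0 ?invr_ge0 ?ler0n //.
rewrite -scalemxAl -scalemxAr scalerA -expr2 sqrtCK.
by rewrite tr_col_mx map_row_mx trmxCK mul_row_col.
Qed.

Lemma loewner_leD n (X1 X2 Y1 Y2 : 'M[C]_n) :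
  loewner_le X1 Y1 -> loewner_le X2 Y2 -> loewner_le (X1 + X2) (Y1 + Y2).
Proof. by move=> le1 le2; rewrite /loewner_le opprD addrACA; apply: psdmxD. Qed.

Lemma qsymmx_triangle n (A B : 'M[C]_n) :
  exists U V : 'M[C]_n,
    [/\ U \is unitarymx, V \is unitarymx &
        loewner_le (qsymmx (A + B))
          (U *m qsymmx A *m U ^t* + V *m qsymmx B *m V ^t*)].
Proof.
(* The contraction [W] coming from A + B serves for [A] and [B] alike: the orbit bound ties [W] to
   neither of them. *)
have [W WT cW] :=
  polar_contraction (qsymmx_psd (A + B)) (qsymmx_sqr_qsymcol (A + B)).
have [U uU leU] :=
  real_part_le_unitary_orbit cW (qsymmx_psd A) (qsymmx_sqr_qsymcol A).
have [V uV leV] :=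
  real_part_le_unitary_orbit cW (qsymmx_psd B) (qsymmx_sqr_qsymcol B).
exists U, V; split; [exact: uU | exact: uV |].
suff -> : qsymmx (A + B) =
    2%:R^-1 *: (W ^t* *m qsymcol A + (qsymcol A) ^t* *m W) +
    2%:R^-1 *: (W ^t* *m qsymcol B + (qsymcol B) ^t* *m W).
  exact: loewner_leD.
rewrite -scalerDr addrACA -mulmxDr -mulmxDl -adjmxD -qsymcolD WT.
(* Taking adjoints in [WT], with a Hermitian right-hand side, shows that W^* T(A + B) is its own
   real part. *)
have -> : (qsymcol (A + B)) ^t* *m W = qsymmx (A + B).
  rewrite -[LHS]trmxCK adjmxM trmxCK WT.
  by have [/[!hermsymmxE]/eqP <- _] := qsymmx_psd (A + B).
by rewrite -mulr2n -scaler_nat scalerA mulVf ?scale1r ?pnatr_eq0.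
Qed.

End Modulus.

Theorem theorem1p9 (R : realType) (n : nat) (A B : 'M[R[i]]_n) :
  exists U V : 'M[R[i]]_n,
    [/\ U \is unitarymx, V \is unitarymx &
        loewner_le (qsymmx (A + B))
          (U *m qsymmx A *m U ^t* + V *m qsymmx B *m V ^t*)].
Proof. exact: qsymmx_triangle. Qed.
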